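(* Let $\lambda=[\lambda_1,\lambda_2,\lambda_3]$ be a partition with three parts. Then $\lambda$ is a $\mathcal{P}$-position of the game CRIM if and only if $\lambda_1$ and $\lambda_2$ are odd and either $\lambda$ is a hook or $\lambda_3>1$.
   Context: A partition is a finite weakly decreasing sequence $\lambda=[\lambda_1,\ldots,\lambda_r]$ of positive integers, called its parts; the empty partition $[\,]$ is allowed. Its conjugate is $\lambda'=[\lambda'_1,\ldots,\lambda'_{\lambda_1}]$, where $\lambda'_k$ is the largest $i$ with $\lambda_i\ge k$. A hook is a partition of the form $[c,1^{r-1}]$ with $r,c\ge1$ (one part $c$ followed by $r-1$ parts equal to $1$). CRIM is the impartial two-player game whose positions are partitions. From $\lambda=[\lambda_1,\ldots,\lambda_r]$, a row move deletes the part $\lambda_i$ for some $1\le i\le r$. A column move takes the conjugate of the partition that results from making a row move on $\lambda'$ (i.e. it removes one column of the Young diagram). Play is normal play: the player to move at the terminal position $[\,]$ loses. A $\mathcal{P}$-position (losing position) is one from which the player who has just moved can force a win.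
   Formalization: The partition [1,1,1] is excluded: it is a hook with odd first and second parts, but it is a single column, so one column move reaches the empty partition and it is not a P-position. *)

(* Defs.v *)
From mathcomp Require Import all_boot.

Set Implicit Arguments.
Unset Strict Implicit.
Unset Printing Implicit Defensive.

Definition is_partition (l : seq nat) : bool := sorted geq l && all (leq 1) l.

(* Parts are numbered from 1 in the mathematics and from 0 by [nth]: the part
   with 0-based index i counts as position i.+1. *)
Definition conj_part (l : seq nat) (k : nat) : nat :=
  \max_(i < size l | k <= nth 0 l i) i.+1.

Definition conj_partition (l : seq nat) : seq nat :=
  [seq conj_part l k | k <- iota 1 (head 0 l)].

Definition is_hook (l : seq nat) : Prop :=
  exists r c : nat, [/\ 1 <= r, 1 <= c & l = c :: nseq r.-1 1].

Definition row_move (l m : seq nat) : Prop :=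
  exists2 i : nat, i < size l & m = take i l ++ drop i.+1 l.

Definition column_move (l m : seq nat) : Prop :=
  exists2 u : seq nat, row_move (conj_partition l) u & m = conj_partition u.

Definition crim_move (l m : seq nat) : Prop := row_move l m \/ column_move l m.

(* Normal play, with [move x y] meaning that the player to move may go from x
   to y.  P: the previous player can force a win; N: the next player can.
   Being inductive, the predicates ask for a win in finitely many moves; a
   terminal position is P because its premise is vacuous. *)
Inductive P_position (T : Type) (move : T -> T -> Prop) (x : T) : Prop :=
  | P_intro of (forall y : T, move x y -> N_position move y)
with N_position (T : Type) (move : T -> T -> Prop) (x : T) : Prop :=
  | N_intro (y : T) of move x y & P_position move y.

Lemma crim_nil_P : P_position crim_move [::].
Proof.
constructor=> y [[i //]|[u [i]]].
by rewrite /conj_partition /=.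
Qed.

Lemma hook_111 : is_hook [:: 1; 1; 1].
Proof. by exists 3, 1. Qed.

(* The hook [1,1,1] is a single column, so one column move ends the game.  It
   therefore has to be excluded from any claim that the three-part hooks with
   odd first part are P-positions. *)
Lemma crim_111_not_P : ~ P_position crim_move [:: 1; 1; 1].
Proof.
have mv : crim_move [:: 1; 1; 1] [::].
  by right; exists [::] => //; exists 0.
case=> /(_ _ mv) [y [[i //]|[u [i]]]].
by rewrite /conj_partition /=.
Qed.

(* Main.v *)
Require Import Defs.
From mathcomp Require Import all_boot.
From mathcomp Require Import zify.

Set Implicit Arguments.
Unset Strict Implicit.

(** A partition with one part is an N-position, since deleting its part ends
    the game.  A partition [[a, b]] is therefore decided by column moves, each
    of which decreases [a] by one, and it is a P-position exactly when [a] is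
    even.  If [a] or [b] is even in [[a, b, c]], deleting a row leaves a two-part
    partition with even first part, so the position is N.  If both are odd,
    every row move leaves an odd first part, and every column move makes [a]
    even; the latter is a winning move only if it removes the last row as well
    and leaves at least two parts, i.e. when [c = 1] and [b > 1], or if it ends
    the game. *)

Lemma P_N_contradiction (T : Type) (move : T -> T -> Prop) (x : T) :
  P_position move x -> N_position move x -> False.
Proof.
(* The recursion is on the derivation that [x] is P: after a reply and a further move, the position
   [z] is again both, with a smaller derivation [Pz]. *)
move: x; fix IH 2 => x [f] [y mxy [g]].
by case: (f y mxy) => z myz Pz; exact: IH z Pz (g z myz).
Qed.

Lemma eq_from_ltn (a b : nat) : (forall k, (k < a) = (k < b)) -> a = b.
Proof.
by move=> eqab; have := eqab a; have := eqab b; lia.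
Qed.

(** With positive entries, the default 0 of [nth] marks the end of the list, so no separate
    comparison of lengths is needed. *)
Lemma eq_from_nth0 (s t : seq nat) :
  all (leq 1) s -> all (leq 1) t -> nth 0 s =1 nth 0 t -> s = t.
Proof.
elim: s t => [|x s IHs] [|y t] //=.
- by move=> _ /andP[y_gt0 _] /(_ 0) /= y0; rewrite -y0 in y_gt0.
- by move=> /andP[x_gt0 _] _ /(_ 0) /= x0; rewrite x0 in x_gt0.
move=> /andP[_ s_gt0] /andP[_ t_gt0] eqst.
by have /= -> := eqst 0; rewrite (IHs t) // => j; have /= := eqst j.+1.
Qed.

Lemma nth_sorted_geq (l : seq nat) (i j : nat) :
  sorted geq l -> i <= j -> nth 0 l j <= nth 0 l i.
Proof.
move=> sl le_ij; case: (ltnP j (size l)) => [lt_jl|/(nth_default 0) -> //].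
have geq_trans : transitive geq by move=> y x z /= ? ?; lia.
by apply: (sorted_leq_nth geq_trans leqnn 0 sl); rewrite // inE; lia.
Qed.

(** Both sides say that the cell in row [j] and column [k], counted from 0, lies in the diagram.
    Conjugates are compared below through this equivalence alone. *)
Lemma ltn_conj_part (l : seq nat) (j k : nat) :
  sorted geq l -> (j < conj_part l k.+1) = (k < nth 0 l j).
Proof.
move=> sl; apply/idP/idP; last first.
  move=> lt_k; have lt_j : j < size l.
    by rewrite ltnNge; apply/negP=> /(nth_default 0) l0; rewrite l0 in lt_k.
  by rewrite /conj_part (bigmax_sup (Ordinal lt_j)).
rewrite ltnNge; apply: contraNT; rewrite -leqNgt => le_k.
apply/bigmax_leqP=> i lt_ki; rewrite ltnNge; apply/negP=> le_ji.
by have := nth_sorted_geq sl le_ji; lia.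
Qed.

Lemma nth_conj_partition (l : seq nat) (k : nat) :
  sorted geq l -> nth 0 (conj_partition l) k = conj_part l k.+1.
Proof.
move=> sl; case: (ltnP k (head 0 l)) => [lt_k|le_k].
  by rewrite (nth_map 0) ?size_iota // nth_iota.
(* Past the last column, the default 0 agrees with the maximum over no rows. *)
rewrite nth_default ?size_map ?size_iota //; apply: eq_from_ltn => j.
by rewrite ltn_conj_part //; have := nth_sorted_geq sl (leq0n j); rewrite nth0; lia.
Qed.

Lemma conj_partition_gt0 (l : seq nat) :
  sorted geq l -> all (leq 1) (conj_partition l).
Proof.
move=> sl; apply/allP=> p /mapP[k k_in ->]; move: k_in; rewrite mem_iota.
case: k => [|k] // lt_k.
by rewrite ltn_conj_part // nth0; lia.
Qed.

Lemma conj_partition_sorted (l : seq nat) :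
  sorted geq l -> sorted geq (conj_partition l).
Proof.
move=> sl; apply/(sortedP 0) => k _; rewrite !nth_conj_partition //=.
rewrite leqNgt; apply/negP; rewrite ltn_conj_part // => lt_k.
(* Otherwise row [conj_part l k.+1] would meet column [k.+1] but not column [k]. *)
by have := ltn_conj_part (conj_part l k.+1) k sl; lia.
Qed.

(** In a weakly decreasing list zeros stand only at the end, so dropping them shifts no index. *)
Lemma nth_filter_gt0 (l : seq nat) :
  sorted geq l -> nth 0 (filter (leq 1) l) =1 nth 0 l.
Proof.
elim: l => [|x l IHl] //= sl j.
case: x sl => [|x] sl; last by case: j => //= j; apply: IHl; exact: path_sorted sl.
have l0 i : nth 0 (0 :: l) i = 0.
  by have := nth_sorted_geq (l := 0 :: l) sl (leq0n i); rewrite leqn0 => /eqP.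
by rewrite l0 /= IHl ?(path_sorted sl) //; exact: (l0 j.+1).
Qed.

Lemma conj_partitionK (l : seq nat) :
  sorted geq l -> conj_partition (conj_partition l) = filter (leq 1) l.
Proof.
move=> sl; have sl' := conj_partition_sorted sl.
apply: eq_from_nth0; [exact: conj_partition_gt0|exact: filter_all|move=> j].
rewrite nth_filter_gt0 // nth_conj_partition //; apply: eq_from_ltn => k.
by rewrite ltn_conj_part // nth_conj_partition // ltn_conj_part.
Qed.

(** Emptied rows stay as zeros, so that rows keep their indices; they are filtered out only when a
    move is described. *)
Definition remove_column (i : nat) (l : seq nat) : seq nat :=
  [seq p - (i < p) | p <- l].

Lemma remove_column_sorted (i : nat) (l : seq nat) :
  sorted geq l -> sorted geq (remove_column i l).
Proof. by apply: homo_sorted => p q /=; lia. Qed.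

Lemma nth_remove_column (i : nat) (l : seq nat) (j : nat) :
  nth 0 (remove_column i l) j = nth 0 l j - (i < nth 0 l j).
Proof. by elim: l j => [|p l IHl] [|j] //=. Qed.

Lemma nth_delete (s : seq nat) (i k : nat) :
  i < size s -> nth 0 (take i s ++ drop i.+1 s) k = nth 0 s (bump i k).
Proof.
move=> lt_i; rewrite nth_cat size_take lt_i /bump.
case: (ltnP k i) => [lt_k|le_k]; first by rewrite nth_take.
by rewrite nth_drop; congr nth; lia.
Qed.

Lemma conj_remove_column (i : nat) (l : seq nat) :
  sorted geq l -> i < head 0 l ->
  conj_partition (remove_column i l) =
  take i (conj_partition l) ++ drop i.+1 (conj_partition l).
Proof.
move=> sl lt_i; have srl := remove_column_sorted i sl.
have /allP l'_gt0 := conj_partition_gt0 sl.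
apply: eq_from_nth0; first exact: conj_partition_gt0.
  by apply/allP=> p; rewrite mem_cat => /orP[/mem_take|/mem_drop]; apply: l'_gt0.
move=> k; rewrite nth_delete ?size_map ?size_iota // !nth_conj_partition //.
(* For a row of length [p], column [k] of the new diagram is column [bump i k] of the old one:
   [k < p - (i < p)] iff [bump i k < p]. *)
apply: eq_from_ltn => j; rewrite !ltn_conj_part // nth_remove_column /bump.
by lia.
Qed.

(** This frees the game analysis from conjugation: column moves are computed directly on the
    rows. *)
Lemma column_moveP (l m : seq nat) :
  sorted geq l ->
  column_move l m <->
  exists2 i, i < head 0 l & m = filter (leq 1) (remove_column i l).
Proof.
move=> sl; have size_l' : size (conj_partition l) = head 0 l.
  by rewrite size_map size_iota.
split=> [[_ [i lt_i ->] ->]|[i lt_i ->]].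
  rewrite size_l' in lt_i; exists i => //.
  by rewrite -conj_remove_column // conj_partitionK ?remove_column_sorted.
exists (conj_partition (remove_column i l)).
  by exists i; rewrite ?size_l' ?conj_remove_column.
by rewrite conj_partitionK ?remove_column_sorted.
Qed.

Lemma one_part_N (a : nat) : N_position crim_move [:: a].
Proof.
by exists [::]; [left; exists 0|exact: crim_nil_P].
Qed.

Lemma two_part_position (a b : nat) :
  0 < b <= a ->
  if odd a then N_position crim_move [:: a; b]
  else P_position crim_move [:: a; b].
Proof.
elim: a b => [|a IHa] b hb; first by lia.
have sab : sorted geq [:: a.+1; b] by rewrite /= andbT; lia.
rewrite /=; case: (boolP (odd a)) => [odd_a|even_a] /=.
  constructor=> _ [[[|[|//]] _ ->]|/(column_moveP _ sab)[i /= lt_i ->]];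
    try exact: one_part_N.
  rewrite lt_i subn1 /= (_ : 0 < a); last by lia.
  case: ifP => [b'_gt0|_]; last exact: one_part_N.
  by have := IHa (b - (i < b)); rewrite odd_a; apply; lia.
have col i : i < a.+1 -> crim_move [:: a.+1; b]
    (filter (leq 1) (remove_column i [:: a.+1; b])).
  by move=> lt_i; right; apply/(column_moveP _ sab); exists i.
(* The winning move must not leave a single part: column 0 is safe if [b > 1], while for [b = 1]
   column 1 spares the second row. From [[:: 1; 1]], column 0 ends the game. *)
case: (ltnP 1 b) => [b_gt1|b_le1].
  exists [:: a; b.-1].
    by have := col 0 isT; case: a b hb b_gt1 {IHa sab even_a col} => [|a] [|[|b]].
  by have := IHa b.-1; rewrite (negbTE even_a); apply; lia.
have b1 : b = 1 by lia.
subst b; case: a => [|a] in IHa hb sab even_a col *.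
  by exists [::]; [exact: (col 0)|exact: crim_nil_P].
exists [:: a.+1; 1]; first by have := col 1 isT; rewrite /= subn1.
by have := IHa 1; rewrite (negbTE even_a); apply; lia.
Qed.

Lemma two_part_P (a b : nat) :
  0 < b <= a -> ~~ odd a -> P_position crim_move [:: a; b].
Proof. by move=> /two_part_position + /negbTE a_even; rewrite a_even. Qed.

Lemma two_part_N (a b : nat) :
  0 < b <= a -> odd a -> N_position crim_move [:: a; b].
Proof. by move=> /two_part_position + a_odd; rewrite a_odd. Qed.

Lemma three_part_N (a b c : nat) :
  0 < c <= b -> b <= a -> ~~ (odd a && odd b) ->
  N_position crim_move [:: a; b; c].
Proof.
move=> hc hb; case: (boolP (odd a)) => /= [_ b_even|a_even _].
  by exists [:: b; c]; [left; exists 0|apply: two_part_P; lia].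
by exists [:: a; c]; [left; exists 1|apply: two_part_P; lia].
Qed.

Lemma three_part_odd_P (a b c : nat) :
  0 < c <= b -> b <= a -> 1 < a -> odd a -> odd b -> (b == 1) || (1 < c) ->
  P_position crim_move [:: a; b; c].
Proof.
move=> hc hb a_gt1 a_odd b_odd hbc.
have sabc : sorted geq [:: a; b; c] by rewrite /= andbT; lia.
constructor=> _ [[[|[|[|//]]] _ ->]|/(column_moveP _ sabc)[i /= lt_i ->]].
- by apply: two_part_N; lia.
- by apply: two_part_N; lia.
- by apply: two_part_N; lia.
rewrite lt_i (_ : 0 < a - true); last by lia.
(* The last row vanishes only if [c = 1] and [i = 0]; then [hbc] gives [b = 1], so the second row
   vanishes too and two parts never remain. *)
case: (ltnP 0 (c - (i < c))) => c'; case: (ltnP 0 (b - (i < b))) => b'.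
- by apply: three_part_N; lia.
- by lia.
- by lia.
- exact: one_part_N.
Qed.

Lemma three_part_odd_N (a b : nat) :
  1 < b <= a -> odd a -> N_position crim_move [:: a; b; 1].
Proof.
move=> hb a_odd; have sab : sorted geq [:: a; b; 1] by rewrite /= andbT; lia.
exists [:: a.-1; b.-1]; last by apply: two_part_P; lia.
right; apply/(column_moveP _ sab); exists 0; first by rewrite /=; lia.
by case: a b hb {a_odd sab} => [|[|a]] [|[|b]].
Qed.

Lemma is_hook3 (a b c : nat) :
  is_hook [:: a; b; c] <-> [/\ 0 < a, b = 1 & c = 1].
Proof.
split=> [[r [d [r_gt0 d_gt0]]]|[a_gt0 -> ->]]; last by exists 3, a.
by case: r r_gt0 => [|[|[|[|r]]]] //= _ [-> -> ->].
Qed.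

Unset Implicit Arguments.
Set Strict Implicit.

Theorem theorem11 (l1 l2 l3 : nat)
    (Hpart : is_partition [:: l1; l2; l3])
    (Hnot111 : [:: l1; l2; l3] <> [:: 1; 1; 1]) :
  P_position crim_move [:: l1; l2; l3] <->
  (odd l1 /\ odd l2 /\ (is_hook [:: l1; l2; l3] \/ 1 < l3)).
Proof.
have [hc hb] : 0 < l3 <= l2 /\ l2 <= l1.
  by move: Hpart; rewrite /is_partition /=; lia.
split=> [Pl|[odd1 [odd2 hl]]]; last first.
  apply: three_part_odd_P => //.
    (* A first part of 1 forces all three parts to be 1, the excluded column. *)
    rewrite ltnNge; apply/negP=> le1; apply: Hnot111.
    by congr [:: _; _; _]; lia.
  by case: hl => [/is_hook3[_ -> _] //|->]; rewrite orbT.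
case: (boolP (odd l1 && odd l2)) => [/andP[odd1 odd2]|not_odd]; last first.
  by case: (P_N_contradiction Pl); exact: three_part_N.
split=> //; split=> //; case: (ltnP 1 l3) => [|l3_le1]; first by right.
have l3E : l3 = 1 by lia.
left; apply/is_hook3; split=> //; first by lia.
case: (ltnP 1 l2) => [l2_gt1|]; last by lia.
case: (P_N_contradiction Pl); rewrite l3E.
by apply: three_part_odd_N; rewrite ?l2_gt1.
Qed.
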